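(* Let $R$ be an admissible local ring with $p\geq 2$ discrete valuation rings, let $\gamma\in\mathbb{N}^p$ be its conductor, and let $I\subseteq \mathrm{Frac}(R)$ be a fractional ideal with dual $I^\vee$. Let $\alpha\in\mathrm{val}(I)$ and $\beta\in\mathrm{val}(I^\vee)$ be such that $\alpha+\beta=\gamma-\underline{1}$, where $\underline{1}=(1,\ldots,1)\in\mathbb{Z}^p$. Then $\beta$ is an absolute maximal of $I^\vee$ if and only if $\alpha$ is a relative maximal of $I$.
   Context: **Admissible rings and values.** Let $(R,\mathfrak{m})$ be a one-dimensional Noetherian local Cohen-Macaulay ring, $\mathrm{Frac}(R)$ its total ring of fractions, $\widetilde{R}$ the integral closure of $R$ in $\mathrm{Frac}(R)$, and $\mathscr{V}$ the set of discrete valuation rings of $\mathrm{Frac}(R)$ over $R$. The ring $R$ is called admissible if (i) its completion $\widehat{R}$ is reduced; (ii) for every maximal ideal $\mathfrak{n}$ of $\widetilde{R}$, $\widetilde{R}/\mathfrak{n}=R/(\mathfrak{n}\cap R)$; (iii) $|R/\mathfrak{m}|\geq|\mathscr{V}|$. Put $p=|\mathscr{V}|$. Under (i), $\widetilde{R}$ is a finite product of semilocal principal ideal domains and $\mathrm{Frac}(R)$ is the product of their fraction fields; the elements of $\mathscr{V}$ correspond to the maximal ideals $\mathfrak{n}$ of $\widetilde{R}$, and the associated valuation of $x\in\mathrm{Frac}(R)$ is the $\mathfrak{n}$-adic valuation of the component of $x$ in the field factor to which $\mathfrak{n}$ belongs ($\infty$ if this component is $0$). Numbering these valuations $\mathrm{val}_1,\ldots,\mathrm{val}_p$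 gives the value map $\mathrm{val}=(\mathrm{val}_1,\ldots,\mathrm{val}_p):\mathrm{Frac}(R)\to(\mathbb{Z}\cup\{\infty\})^p$. **Fractional ideals.** A fractional ideal is an $R$-submodule $I\subseteq\mathrm{Frac}(R)$ containing a non zero divisor of $\mathrm{Frac}(R)$ and such that $gI\subseteq R$ for some non zero divisor $g\in R$. Its set of values is $\mathrm{val}(I)=\{\mathrm{val}(g): g\in I \text{ a non zero divisor}\}\subset\mathbb{Z}^p$. **Dual and conductor.** For $I,J\subseteq \mathrm{Frac}(R)$ put $(I:J)=\{a\in\mathrm{Frac}(R): aJ\subseteq I\}$. A canonical ideal is a fractional ideal $K$ such that $(K:(K:I))=I$ for all fractional ideals $I$. It is known that there is a canonical ideal $K^0$, unique up to multiplication by an invertible element of $\widetilde{R}$, with $R\subseteq K^0\subseteq\widetilde{R}$; fix one. The dual of $I$ is $I^\vee=(K^0:I)$. The conductor ideal is $\mathcal{C}_R=\widetilde{R}^\vee$, and the conductor of $R$ is the element $\gamma\in\mathbb{N}^p$ such that $\mathcal{C}_R=\{x\in\mathrm{Frac}(R):\mathrm{val}(x)\geq\gamma\}$ (so $\mathrm{val}(\mathcal{C}_R)=\gamma+\mathbb{N}^p$). **Maximals.** $\mathbb{Z}^p$ carries the product order. For $\alpha\in\mathbb{Z}^p$, $J\subseteq\{1,\ldots,p\}$ and a fractional ideal $I$, let $\Delta_J(\alpha,I)=\{v\in\mathrm{val}(I): v_j=\alpha_j\ \forall j\in J,\ v_j>\alpha_j\ \forall j\notin J\}$, $\Delta_i(\alpha,I)=\Delta_{\{i\}}(\alpha,I)$,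 and $\Delta(\alpha,I)=\bigcup_{i=1}^p\Delta_i(\alpha,I)$. An element $\alpha\in\mathrm{val}(I)$ is: - an absolute maximal of $I$ if $\Delta_J(\alpha,I)=\emptyset$ for all $J\subseteq\{1,\ldots,p\}$ with $J\neq\emptyset$ and $J\neq\{1,\ldots,p\}$; - a relative maximal of $I$ if $\Delta(\alpha,I)=\emptyset$ and $\Delta_J(\alpha,I)\neq\emptyset$ for all $J\subseteq\{1,\ldots,p\}$ with $|J|\geq 2$. *)

(* Defs.v *)
From HB Require Import structures.
From mathcomp Require Import all_boot all_order all_algebra.
From mathcomp Require Import all_classical.
From mathcomp Require Import constructive_ereal.

Set Implicit Arguments.
Unset Strict Implicit.
Unset Printing Implicit Defensive.

Import Order.TTheory GRing.Theory Num.Theory.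
Local Open Scope classical_set_scope.
Local Open Scope card_scope.
Local Open Scope ring_scope.

(* Non zero divisors of a commutative ring are the elements x satisfying
   GRing.lreg x, i.e. such that multiplication by x is injective. *)

(* Ideals of a subring S of A; S = setT gives the ideals of A itself. *)
Definition is_ideal (A : comNzRingType) (S I : set A) : Prop :=
  [/\ I `<=` S, I 0, (forall x y, I x -> I y -> I (x + y))
    & (forall a x, S a -> I x -> I (a * x))].

Definition maximal_ideal (A : comNzRingType) (S I : set A) : Prop :=
  [/\ is_ideal S I, I <> S
    & forall J, is_ideal S J -> I `<=` J -> J = I \/ J = S].

Definition prime_ideal (A : comNzRingType) (P : set A) : Prop :=
  [/\ is_ideal setT P, P <> setT
    & forall x y, P (x * y) -> P x \/ P y].

Definition generated_ideal (A : comNzRingType) (G : set A) : set A :=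
  smallest (is_ideal setT) G.

Definition reduced (A : comNzRingType) : Prop :=
  forall (x : A) (n : nat), x ^+ n = 0 -> x = 0.

Definition noetherian (A : comNzRingType) : Prop :=
  forall I : set A, is_ideal setT I ->
    exists s : seq A, I = generated_ideal [set` s].

Definition prime_chain (A : comNzRingType) (n : nat) (P : nat -> set A) : Prop :=
  (forall i, (i <= n)%N -> prime_ideal (P i)) /\
  (forall i, (i < n)%N -> P i `<` P i.+1).

Definition krull_dim (A : comNzRingType) (d : nat) : Prop :=
  (exists P : nat -> set A, prime_chain d P) /\
  (forall n (P : nat -> set A), prime_chain n P -> (n <= d)%N).

Section LocalRings.
Variables (R : comNzRingType) (m : idealr R).

Definition local_ring : Prop :=
  forall n : set R, maximal_ideal setT n <-> n = [set` m].

(* s_i is a non zero divisor modulo (s_0, ..., s_(i-1)); the quotient by all of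
   s is nonzero because s lies in the proper ideal m. *)
Definition regular_sequence (s : seq R) : Prop :=
  {subset s <= m} /\
  forall i, (i < size s)%N -> forall x : R,
    generated_ideal [set` take i s] (s`_i * x) ->
    generated_ideal [set` take i s] x.

Definition depth (d : nat) : Prop :=
  (exists2 s, regular_sequence s & size s = d) /\
  (forall s, regular_sequence s -> (size s <= d)%N).

Definition cohen_macaulay : Prop := exists2 d, krull_dim R d & depth d.

End LocalRings.

(* The m-adic completion, lim_n R / m ^ n: the ring of coherent sequences of
   elements of R, modulo the ideal of those which vanish in every R / m ^ n. *)
Section Completion.
Variables (R : comNzRingType) (m : idealr R).

Fixpoint ideal_exp (n : nat) : set R :=
  if n is n'.+1 then
    generated_ideal [set a * b | a in [set` m] & b in ideal_exp n']
  else setT.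

Lemma ideal_exp_ideal n : is_ideal setT (ideal_exp n).
Proof.
case: n => [|n] /=; first by split.
split=> [//| J [[_ J0 _ _] _] //| x y Ix Iy J JP | a x Sa Ix J JP].
- by case: (JP) => -[_ _ JD _] _; apply: JD; [apply: Ix | apply: Iy].
- by case: (JP) => -[_ _ _ JM] _; apply: JM => //; apply: Ix.
Qed.

Lemma ideal_exp0 n : ideal_exp n 0.
Proof. by case: (ideal_exp_ideal n). Qed.

Lemma ideal_expD n x y :
  ideal_exp n x -> ideal_exp n y -> ideal_exp n (x + y).
Proof. by case: (ideal_exp_ideal n) => _ _ ID _; apply: ID. Qed.

Lemma ideal_expM n a x : ideal_exp n x -> ideal_exp n (a * x).
Proof. by case: (ideal_exp_ideal n) => _ _ _ IM; apply: IM. Qed.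

Lemma ideal_expB n x y :
  ideal_exp n x -> ideal_exp n y -> ideal_exp n (x - y).
Proof.
by move=> Ix Iy; apply: ideal_expD => //; rewrite -mulN1r; apply: ideal_expM.
Qed.

Lemma ideal_exp1 : ideal_exp 1 `<=` [set` m].
Proof.
apply: smallest_sub => [|_ [a am [b _ <-]] /=]; first split=> //=.
- exact: idealr0.
- by move=> ? ? ? ?; apply: rpredD.
- by move=> ? ? _ ?; apply: idealMr.
- by rewrite mulrC; apply: idealMr.
Qed.

Definition coherent : {pred nat -> R} :=
  fun x => `[< forall n, ideal_exp n (x n.+1 - x n) >].

Lemma coherentP x :
  reflect (forall n, ideal_exp n (x n.+1 - x n)) (x \in coherent).
Proof. exact: asboolP. Qed.

Fact coherent_subring_closed : subring_closed coherent.
Proof.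
split=> [|x y /coherentP cx /coherentP cy|x y /coherentP cx /coherentP cy].
- by apply/coherentP => n; rewrite subrr; apply: ideal_exp0.
- apply/coherentP => n; rewrite [X in ideal_exp n X](_ : _ =
    (x n.+1 - x n) - (y n.+1 - y n)); first exact: ideal_expB.
  by rewrite /= !fctE !opprB addrACA [RHS]addrACA [- y _ - _]addrC.
- apply/coherentP => n; rewrite [X in ideal_exp n X](_ : _ =
    x n.+1 * (y n.+1 - y n) + y n * (x n.+1 - x n)).
    by apply: ideal_expD; apply: ideal_expM.
  by rewrite !mulrBr [y n * x n.+1]mulrC [y n * x n]mulrC addrA subrK.
Qed.

HB.instance Definition _ :=
  GRing.isSubringClosed.Build (nat -> R) coherent coherent_subring_closed.

Record coherent_seq := CoherentSeq {
  coherent_val :> nat -> R;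
  _ : coherent_val \in coherent }.

HB.instance Definition _ := [isSub for coherent_val].
HB.instance Definition _ := [Choice of coherent_seq by <:].
HB.instance Definition _ := [SubChoice_isSubComNzRing of coherent_seq by <:].

Definition null_seq : {pred coherent_seq} :=
  fun x => `[< forall n, ideal_exp n (coherent_val x n) >].

Fact null_seq_idealr_closed : idealr_closed null_seq.
Proof.
split=> [||a x y /asboolP nx /asboolP ny].
- by apply/asboolP => n; apply: ideal_exp0.
- by apply/negP => /asboolP /(_ 1%N) /ideal_exp1 /=; rewrite idealr1.
- apply/asboolP => n; apply: ideal_expD => //.
  exact: ideal_expM.
Qed.

HB.instance Definition _ :=
  isIdealr.Build coherent_seq null_seq null_seq_idealr_closed.

Definition completion : comNzRingType := {ideal_quot null_seq}.

End Completion.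

(* iota : R -> Q makes Q the total ring of fractions of R. *)
Definition total_fractions (R : comNzRingType) (Q : comUnitRingType)
    (iota : {rmorphism R -> Q}) : Prop :=
  [/\ injective iota,
      (forall r, GRing.lreg r -> iota r \is a GRing.unit)
    & (forall x, exists a b, GRing.lreg b /\ x = iota a / iota b)].

(* Discrete valuations of a total ring of fractions, normalised by being onto
   Z u {oo}. The ring need not be a domain: v ^-1 (oo) is a prime ideal, so v
   is the valuation of one factor when Q is a product of fields. *)
Definition discrete_valuation (Q : comNzRingType) (v : Q -> \bar int) : Prop :=
  [/\ range v = [set t | t <> -oo%E],
      v 0 = +oo%E,
      v 1 = 0%:E,
      (forall x y, v (x * y) = (v x + v y)%E)
    & (forall x y, (Order.min (v x) (v y) <= v (x + y)%R)%E)].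

Definition valuation_ring (Q : comNzRingType) (v : Q -> \bar int) : set Q :=
  [set x | (0%:E <= v x)%E].

Definition colon (Q : comNzRingType) (I J : set Q) : set Q :=
  [set a | forall x, J x -> I (a * x)].

Section Fractions.
Variables (R : comNzRingType) (Q : comUnitRingType) (iota : {rmorphism R -> Q}).

Definition integral_closure : set Q := [set x | integralOver iota x].

Definition dvrs_over : set (set Q) :=
  [set V | range iota `<=` V /\
           exists2 v, discrete_valuation v & V = valuation_ring v].

(* The injection of R / (n cap R) into R~ / n, for n a maximal ideal of the
   integral closure R~, is onto. *)
Definition residually_rational : Prop :=
  forall n : set Q, maximal_ideal integral_closure n ->
  forall x, integral_closure x -> exists r, n (x - iota r).

Definition admissible (m : idealr R) : Prop :=
  [/\ local_ring m, noetherian R, krull_dim R 1 & cohen_macaulay m] /\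
  [/\ reduced (completion m),
      residually_rational
    & dvrs_over #<= [set: {ideal_quot m}]].

Definition submodule (I : set Q) : Prop :=
  [/\ I 0, (forall x y, I x -> I y -> I (x + y))
    & (forall r x, I x -> I (iota r * x))].

Definition fractional_ideal (I : set Q) : Prop :=
  [/\ submodule I,
      (exists2 x, I x & GRing.lreg x)
    & (exists2 g : R, GRing.lreg g &
         forall x, I x -> range iota (iota g * x))].

Definition canonical_ideal (K : set Q) : Prop :=
  fractional_ideal K /\
  forall I, fractional_ideal I -> colon K (colon K I) = I.

Definition conductor_ideal (K : set Q) : set Q := colon K integral_closure.

Section Values.
Variables (p : nat) (val : 'I_p -> Q -> \bar int).

(* val_1, ..., val_p are the valuations of the elements of dvrs_over, listed
   without repetition; in particular p is the cardinal of dvrs_over. *)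
Definition value_map : Prop :=
  (forall i, discrete_valuation (val i)) /\
  set_bij [set: 'I_p] dvrs_over (fun i => valuation_ring (val i)).

Definition values (I : set Q) : set {ffun 'I_p -> int} :=
  [set v : {ffun 'I_p -> int} | exists g, [/\ I g, GRing.lreg g & forall i, val i g = (v i)%:E]].

Definition conductor (K : set Q) (gamma : {ffun 'I_p -> nat}) : Prop :=
  conductor_ideal K =
  [set x | forall i, (((gamma i)%:Z)%:E <= val i x)%E].

Definition Delta_set (J : {set 'I_p}) (alpha : {ffun 'I_p -> int}) (I : set Q) :
    set {ffun 'I_p -> int} :=
  [set v : {ffun 'I_p -> int} | values I v /\
    (forall j, if j \in J then v j = alpha j else alpha j < v j)].

Definition Delta (alpha : {ffun 'I_p -> int}) (I : set Q) :
    set {ffun 'I_p -> int} :=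
  \bigcup_i Delta_set [set i]%SET alpha I.

Definition absolute_maximal (alpha : {ffun 'I_p -> int}) (I : set Q) : Prop :=
  values I alpha /\
  forall J : {set 'I_p}, J != finset.set0 -> J != [set: 'I_p]%SET ->
    Delta_set J alpha I = set0.

Definition relative_maximal (alpha : {ffun 'I_p -> int}) (I : set Q) : Prop :=
  [/\ values I alpha,
      Delta alpha I = set0
    & forall J : {set 'I_p}, (2 <= #|J|)%N -> Delta_set J alpha I !=set0].

End Values.
End Fractions.

(* Main.v *)
(* Write C = (K : R~) = {val >= gamma}. Any y with val y = oo satisfies y Q <= C,
   hence g y Q <= R for a regular g, and y = 0 by Krull's intersection theorem;
   so an element with finite values is a unit. As C contains a regular element,
   R~ is a fractional ideal and duality gives R~ = (K : C) = {val >= 0}. The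
   valuations being pairwise distinct and at most as many as the residues,
   (x - c)^-1 for a well chosen residue c separates two of them, so that every
   vector of integers is the value of a unit.

   Two facts then suffice. If x is in I and y in the dual of I, then xy is in K
   and cannot have value gamma_i - 1 at i and at least gamma_j at all j <> i
   (maximality of C). Conversely, if no x in I with val x >= f has val_i x = f_i,
   then I /\ {val >= f} = I /\ {val >= f + e_i}; dualising, I^v contains some y
   with val_i y = gamma_i - 1 - f_i and val_j y >= gamma_j - f_j for j <> i.
   For alpha + beta = gamma - 1, an element of Delta_J(beta, I^v) contradicts one
   of Delta_(J^c u {j})(alpha, I) when j is in J, by the first fact; and the
   second one, applied to alpha + 1_(J^c) and i in J, together with a generic
   combination over i in J, gives an element of Delta_J(alpha, I). *)

Require Import Defs.
From mathcomp Require Import all_boot all_order all_algebra.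
From mathcomp Require Import all_classical.
From mathcomp Require Import constructive_ereal.
From mathcomp Require Import zify.

Set Implicit Arguments.
Unset Strict Implicit.
Unset Printing Implicit Defensive.

Import Order.TTheory GRing.Theory Num.Theory.
Local Open Scope classical_set_scope.
Local Open Scope ring_scope.

(** * Discrete valuations *)

Section DiscreteValuation.
Variables (Q : comNzRingType) (v : Q -> \bar int).
Hypothesis dv : discrete_valuation v.

Lemma val0 : v 0 = +oo%E. Proof. by case: dv. Qed.

Lemma val1 : v 1 = 0%:E. Proof. by case: dv. Qed.

Lemma valM x y : v (x * y) = (v x + v y)%E. Proof. by case: dv. Qed.

Lemma val_neqNy x : v x <> -oo%E.
Proof.
case: dv => rv _ _ _ _; have : range v (v x) by exists x.
by rewrite rv.
Qed.

Lemma val_fin x : v x <> +oo%E -> exists a, v x = a%:E.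
Proof. by have := @val_neqNy x; case: (v x) => // a _ _; exists a. Qed.

Lemma val_onto (a : int) : exists x, v x = a%:E.
Proof.
case: dv => rv _ _ _ _; have : [set t | t <> -oo%E] a%:E by [].
by rewrite -rv => -[x _ vx]; exists x.
Qed.

Lemma val_geD t x y : (t <= v x -> t <= v y -> t <= v (x + y))%E.
Proof.
case: dv => _ _ _ _ vD tx ty; apply: le_trans (vD x y).
by rewrite le_min tx ty.
Qed.

Lemma valM_infty x y : v x = +oo%E -> v (x * y) = +oo%E.
Proof. by rewrite valM => ->; have := @val_neqNy y; case: (v y). Qed.

Lemma valME x y a b : v x = a%:E -> v y = b%:E -> v (x * y) = (a + b)%:E.
Proof. by rewrite valM => -> ->. Qed.

Lemma val_geM x y (a b : int) :
  (a%:E <= v x -> b%:E <= v y -> (a + b)%:E <= v (x * y))%E.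
Proof. by rewrite valM EFinD => ax bx; apply: leeD. Qed.

Lemma valXE x a n : v x = a%:E -> v (x ^+ n) = (a *+ n)%:E.
Proof.
move=> vx; elim: n => [|n IHn]; first by rewrite expr0 val1.
by rewrite exprS mulrS; apply: valME.
Qed.

Lemma valN1 : v (-1) = 0%:E.
Proof.
have vv : (v (-1) + v (-1) = 0%:E)%E by rewrite -valM mulrNN mulr1 val1.
have [a va] : exists a, v (-1) = a%:E.
  by apply: val_fin => vy; rewrite vy in vv.
move: vv; rewrite va -EFinD => -[] /eqP.
by rewrite -mulr2n mulrn_eq0 /= => /eqP ->.
Qed.

Lemma valN x : v (- x) = v x.
Proof. by rewrite -mulN1r valM valN1 add0e. Qed.

Lemma val_geB t x y : (t <= v x -> t <= v y -> t <= v (x - y))%E.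
Proof. by move=> tx ty; apply: val_geD; rewrite ?valN. Qed.

Lemma val_gtD (a : int) x y : (a%:E < v x -> a%:E < v y -> a%:E < v (x + y))%E.
Proof.
case: dv => _ _ _ _ vD tx ty; apply: lt_le_trans (vD x y).
by rewrite lt_min tx ty.
Qed.

Lemma val_gtB (a : int) x y : (a%:E < v x -> a%:E < v y -> a%:E < v (x - y))%E.
Proof. by move=> tx ty; apply: val_gtD; rewrite ?valN. Qed.

(** If the sum had a larger value, so would [x], the difference of [x + y] and [y]. *)
Lemma valD_lt (a : int) x y : v x = a%:E -> (a%:E < v y)%E -> v (x + y) = a%:E.
Proof.
move=> vx ay; apply/eqP; rewrite eq_le [X in _ && X]val_geD ?vx ?(ltW ay) //.
rewrite andbT leNgt; apply/negP => axy.
have := val_gtB axy ay; by rewrite addrK vx ltxx.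
Qed.

Lemma val_ge_sum (t : \bar int) (J : Type) (r : seq J) (P : pred J)
    (F : J -> Q) :
  (forall i, P i -> t <= v (F i))%E -> (t <= v (\sum_(i <- r | P i) F i))%E.
Proof.
move=> tF; elim/big_rec: _ => [|i x Pi tx]; first by rewrite val0 leey.
by apply: val_geD => //; apply: tF.
Qed.

Lemma val_prod_eq0 (J : Type) (r : seq J) (P : pred J) (F : J -> Q) :
  (forall i, P i -> v (F i) = 0%:E) -> v (\prod_(i <- r | P i) F i) = 0%:E.
Proof.
move=> F0; elim/big_rec: _ => [|i x Pi vx]; first exact: val1.
by rewrite valM F0 // vx adde0.
Qed.

Lemma val_prod_ge0 (J : Type) (r : seq J) (P : pred J) (F : J -> Q) :
  (forall i, P i -> 0%:E <= v (F i))%E ->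
  (0%:E <= v (\prod_(i <- r | P i) F i))%E.
Proof.
move=> F0; elim/big_rec: _ => [|i x Pi vx]; first by rewrite val1.
by rewrite valM adde_ge0 // F0.
Qed.

End DiscreteValuation.

Section DiscreteValuationUnit.
Variables (Q : comUnitRingType) (v : Q -> \bar int).
Hypothesis dv : discrete_valuation v.

Lemma val_unit x : x \is a GRing.unit -> exists a, v x = a%:E.
Proof.
move=> ux; apply: (val_fin dv) => vx.
have := valM dv x x^-1; rewrite mulrV // (val1 dv) vx.
by have := @val_neqNy _ _ dv x^-1; case: (v x^-1).
Qed.

Lemma valV x a : x \is a GRing.unit -> v x = a%:E -> v x^-1 = (- a)%:E.
Proof.
move=> ux vx; have := valM dv x x^-1; rewrite mulrV // (val1 dv) vx.
have [|b ->] := @val_unit x^-1; first by rewrite unitrV.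
by rewrite -EFinD => -[/eqP]; rewrite eq_sym addrC addr_eq0 => /eqP ->.
Qed.

End DiscreteValuationUnit.

(** Values are integers or infinite, so strict bounds become large ones, to which [val_geM]
    applies. *)
Lemma lt_EFinS (a : int) (t : \bar int) : (a%:E < t)%E = ((a + 1)%:E <= t)%E.
Proof. by case: t => [b||]; rewrite ?lte_fin ?lee_fin ?lezD1 ?ltry ?leey. Qed.

(** * Prime ideals and local rings *)

Section CommutativeAlgebra.
Variable A : comNzRingType.
Implicit Types (S I J : set A) (a b c x y z : A).

Lemma ideal_neqT I : is_ideal setT I -> I <> setT -> ~ I 1.
Proof.
case=> _ _ _ IM INT I1; apply: INT; apply/seteqP; split=> // x _.
by rewrite -[x]mulr1; apply: IM.
Qed.

Lemma add_ideal I x : is_ideal setT I ->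
  is_ideal setT [set y | exists a b, I a /\ y = a + b * x].
Proof.
case=> _ I0 ID IM; split=> //.
- by exists 0, 0; rewrite mul0r addr0.
- move=> _ _ [a [b [Ia ->]]] [c [d [Ic ->]]]; exists (a + c), (b + d).
  by split; [apply: ID|rewrite mulrDl addrACA].
- move=> z _ _ [a [b [Ia ->]]]; exists (z * a), (z * b).
  by split; [apply: IM|rewrite mulrDr mulrA].
Qed.

Lemma maximal_ideal_prime I : maximal_ideal setT I -> prime_ideal I.
Proof.
case=> idI INT maxI; split=> // x y Ixy; case: (idI) => _ I0 ID IM.
have [Ix|nIx] := pselect (I x); [by left|right].
case: (maxI _ (add_ideal x idI)).
- by move=> a Ia; exists a, 0; rewrite mul0r addr0.
- move=> E; exfalso; apply: nIx; rewrite -E.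
  by exists 0, 1; rewrite mul1r add0r.
- move/seteqP => [_ /(_ 1)[]// a [b [Ia E]]].
  rewrite -[y]mul1r E mulrDl; apply: ID; first by rewrite mulrC; apply: IM.
  by rewrite -mulrA; apply: IM.
Qed.

(** Used twice: [S = [set 1]] yields maximal ideals, a multiplicative [S] prime ones. *)
Lemma exists_max_disjoint S J : is_ideal setT J -> J `&` S = set0 ->
  exists P, [/\ is_ideal setT P, J `<=` P, P `&` S = set0 &
    forall P', is_ideal setT P' -> P `<=` P' -> P' `&` S = set0 -> P' = P].
Proof.
move=> idJ JS.
(* Joining J to the members of the family makes the empty chain harmless. *)
pose good X := is_ideal setT (J `|` X) /\ (J `|` X) `&` S = set0.
have [|X [[idX XS] maxX]] := @Zorn_bigcup A good.
  move=> F Fgood Ftot.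
  have [F0|/set0P[X0 FX0]] := eqVneq F set0.
    by rewrite F0 bigcup_set0 /good setU0.
  have UE : J `|` \bigcup_(X in F) X = \bigcup_(X in F) (J `|` X).
    apply/seteqP; split=> x.
      by move=> [Jx|[X FX Xx]]; [exists X0 => //; left|exists X => //; right].
    by move=> [X FX [Jx|Xx]]; [left|right; exists X].
  rewrite /good UE; split; first split=> //.
  - by exists X0 => //; left; case: idJ.
  - move=> x y [X FX Xx] [Y FY Yy].
    have [XY|YX] := Ftot _ _ FX FY.
      exists Y => //; have [[_ _ YD _] _] := Fgood _ FY; apply: YD => //.
      by case: Xx => [|/XY]; [left|right].
    exists X => //; have [[_ _ XD _] _] := Fgood _ FX; apply: XD => //.
    by case: Yy => [|/YX]; [left|right].
  - move=> a x _ [X FX Xx]; exists X => //.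
    by have [[_ _ _ XM] _] := Fgood _ FX; apply: XM.
  - rewrite -subset0 => x [[X FX Xx] Sx].
    by have [_ <-] := Fgood _ FX.
exists (J `|` X); split=> // P idP XP PS.
have JP : J `|` P = P by apply/setUidPr => x Jx; apply: XP; left.
apply/seteqP; split=> //; apply: contrapT => nPX.
apply: (maxX P); last by rewrite /good JP.
split; last by move=> PX; apply: nPX => x /PX; right.
by move=> x Xx; apply: XP; right.
Qed.

Lemma exists_prime_disjoint S : S 1 -> ~ S 0 ->
    (forall x y, S x -> S y -> S (x * y)) ->
  exists2 P, prime_ideal P & P `&` S = set0.
Proof.
move=> S1 nS0 SM.
have [||P [idP _ PS maxP]] := @exists_max_disjoint S [set 0].
- split=> // [x y -> ->|a x _ ->]; first by rewrite /= addr0.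
  by rewrite /= mulr0.
- by rewrite -subset0 => x [/= ->].
(* By maximality, adjoining to [P] an element outside it creates an element of [S]; for two such
   elements, the product of the elements obtained stays in [S] and would fall in [P]. *)
have disj x : P x -> S x -> False.
  by move=> Px Sx; have : (P `&` S) x by []; rewrite PS.
have meet x : ~ P x -> exists a b, P a /\ S (a + b * x).
  move=> nPx; apply: contrapT => nS; apply: nPx.
  rewrite -(maxP _ (add_ideal x idP)).
  - by exists 0, 1; split; [case: idP|rewrite mul1r add0r].
  - by move=> a Pa; exists a, 0; rewrite mul0r addr0.
  - rewrite -subset0 => _ [[a [b [Pa ->]]] Sx].
    by apply: nS; exists a, b.
exists P => //; split=> //.
  by move=> PT; apply: (disj 1); rewrite // PT.
move=> x y Pxy; apply: contrapT => /not_orP[/meet[a [b [Pa Sa]]]].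
move=> /meet[c [d [Pc Sc]]]; apply: (disj _ _ (SM _ _ Sa Sc)).
case: idP => _ _ PD PM; rewrite mulrDl; apply: (PD).
  by rewrite mulrC; apply: PM.
rewrite mulrDr; apply: PD; first exact: PM.
by rewrite mulrACA; apply: PM.
Qed.

(* A prime avoiding the products b ^+ n * s, s outside P, lies strictly below
   P. *)
Lemma prime_below P b : prime_ideal P -> P b -> GRing.lreg b ->
  exists2 P', prime_ideal P' & P' `<` P.
Proof.
move=> primeP Pb regb; have [idP PT PP] := primeP.
pose S := [set x | exists n s, ~ P s /\ x = b ^+ n * s].
have [|||P' primeP' P'S] := @exists_prime_disjoint S.
- by exists 0, 1; split; [apply: ideal_neqT|rewrite expr0 mul1r].
- move=> [n [s [nPs /esym/eqP]]].
  rewrite -(mulr0 (b ^+ n)) => /eqP /(lregX regb) s0.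
  by apply: nPs; rewrite s0; case: idP.
- move=> _ _ [n [s [nPs ->]]] [k [t [nPt ->]]].
  exists (n + k)%N, (s * t); split; first by case/PP.
  by rewrite mulrACA exprD.
have disj x : P' x -> S x -> False.
  by move=> Px Sx; have : (P' `&` S) x by []; rewrite P'S.
exists P' => //; split=> [x P'x|PP'].
  apply: contrapT => nPx; apply: (disj x P'x).
  by exists 0, x; rewrite expr0 mul1r.
apply: (disj b); first exact: PP'.
by exists 1, 1; split; [apply: ideal_neqT|rewrite expr1 mulr1].
Qed.

Lemma krull_dim1_prime P b I : krull_dim A 1 -> maximal_ideal setT I ->
  prime_ideal P -> P `<=` I -> P b -> GRing.lreg b -> P = I.
Proof.
move=> [_ dim1] maxI primeP PI Pb regb; apply: contrapT => nPI.
have [P0 primeP0 P0P] := prime_below primeP Pb regb.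
(* The default value [I] of [nth] is the third term of the chain. *)
suff /dim1 : prime_chain 2 (nth I [:: P0; P]) by [].
split=> [[|[|[|]]]//= _|[|[|]]//= _].
  exact: maximal_ideal_prime.
by split=> // IP; apply: nPI; apply/seteqP.
Qed.

End CommutativeAlgebra.

(** * Local rings and Krull's intersection theorem *)

Section LocalRing.
Variables (R : comNzRingType) (m : idealr R).
Hypothesis locR : local_ring m.

Lemma local_maximal : maximal_ideal setT [set` m].
Proof. by apply/locR. Qed.

Lemma local_inv x : x \notin m -> exists y, x * y = 1.
Proof.
move=> nmx; apply: contrapT => nx.
pose J := [set y | exists a, y = a * x].
have idJ : is_ideal setT J.
  split=> //; first by exists 0; rewrite mul0r.
    by move=> _ _ [a ->] [b ->]; exists (a + b); rewrite mulrDl.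
  by move=> a _ _ [b ->]; exists (a * b); rewrite mulrA.
have [|P [idP JP P1 maxP]] := @exists_max_disjoint _ [set 1] J idJ.
  rewrite -subset0 => y [[a /= ->] E].
  by apply: nx; exists a; rewrite mulrC.
have nP1 : ~ P 1 by move=> P1'; have : (P `&` [set 1]) 1 by []; rewrite P1.
have /locR Pm : maximal_ideal setT P.
  split=> // [PT|J' idJ' PJ'].
    by apply: nP1; rewrite PT.
  have [->|J'T] := pselect (J' = setT); [by right|left].
  apply: maxP => //; rewrite -subset0 => t [J't tE].
  by move: J't; rewrite tE => /(ideal_neqT idJ' J'T).
have : P x by apply: JP; exists 1; rewrite mul1r.
by rewrite Pm /= (negPf nmx).
Qed.

(** The ideals generated by the [r n] increase, hence stop at some [N]. Then [r N.+1] is a multiple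
    of [r N], so it is killed by some [1 - a * b], which is invertible. *)
Lemma krull_intersection (b : R) (r : nat -> R) : noetherian R -> b \in m ->
  (forall n, r n = b * r n.+1) -> r 0%N = 0.
Proof.
move=> noethR mb rS.
have rD n k : r n = b ^+ k * r (n + k)%N.
  elim: k => [|k IHk]; first by rewrite mul1r addn0.
  by rewrite IHk rS exprSr mulrA addnS.
pose U := [set y | exists n a, y = a * r n].
have [|s Us] := noethR U.
  split=> //; first by exists 0%N, 0; rewrite mul0r.
    move=> _ _ [n [a ->]] [k [c ->]]; exists (n + k)%N.
    exists (a * b ^+ k + c * b ^+ n).
    by rewrite mulrDl -!mulrA -rD [(n + k)%N]addnC -rD.
  by move=> a _ _ [n [c ->]]; exists n, (a * c); rewrite mulrA.
have [N UN] : exists N, U `<=` [set y | exists a, y = a * r N].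
  suff [N sN] : exists N, [set` s] `<=` [set y | exists a, y = a * r N].
    exists N; rewrite Us; apply: smallest_sub => //; split=> //.
    - by exists 0; rewrite mul0r.
    - by move=> _ _ [a ->] [c ->]; exists (a + c); rewrite mulrDl.
    - by move=> a _ _ [c ->]; exists (a * c); rewrite mulrA.
  have : [set` s] `<=` U by rewrite Us; exact: sub_gen_smallest.
  elim: s {Us} => [|x s IHs] sU; first by exists 0%N.
  have [|N sN] := IHs; first by move=> y sy; apply: sU; rewrite /= inE sy orbT.
  have [|n [a xE]] := sU x; first by rewrite /= inE eqxx.
  exists (N + n)%N => y /=; rewrite inE => /orP[/eqP ->|/sN[c ->]].
    by exists (a * b ^+ N); rewrite xE (rD n N) addnC mulrA.
  by exists (c * b ^+ n); rewrite (rD N n) mulrA.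
have [|a rE] := UN (r N.+1); first by exists N.+1, 1; rewrite mul1r.
have [|c cE] := @local_inv (1 - a * b).
  apply/negP => mab; have := idealr1 m; rewrite -(subrK (a * b) 1).
  by rewrite rpredD // idealMr.
have r0 : (1 - a * b) * r N.+1 = 0.
  by rewrite mulrBl mul1r {1}rE [r N]rS mulrA subrr.
have rN0 : r N.+1 = 0 by rewrite -[r _]mul1r -cE mulrAC r0 mul0r.
by rewrite (rD 0%N N.+1) add0n rN0 mulr0.
Qed.

End LocalRing.
(** * Fractional ideals and duality *)

Section FractionalIdeals.
Variables (R : comNzRingType) (Q : comUnitRingType) (iota : {rmorphism R -> Q}).
Hypothesis frac : total_fractions iota.

Lemma iota_inj : injective iota. Proof. by case: frac. Qed.

Lemma iota_unit r : GRing.lreg r -> iota r \is a GRing.unit.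
Proof. by case: frac => _ + _; apply. Qed.

Lemma lreg_numerator (x : Q) (a b : R) :
  GRing.lreg x -> GRing.lreg b -> x * iota b = iota a -> GRing.lreg a.
Proof.
move=> regx regb xb c d /(congr1 iota); rewrite !rmorphM -xb -!mulrA => /regx.
by rewrite -!rmorphM => /iota_inj /regb.
Qed.

Lemma lreg_unit (x : Q) : GRing.lreg x -> x \is a GRing.unit.
Proof.
move=> regx; case: frac => _ _ /(_ x)[a [b [regb xE]]].
have ub := iota_unit regb.
have rega : GRing.lreg a by apply: (lreg_numerator regx regb); rewrite xE divrK.
by rewrite xE unitrM unitrV ub iota_unit.
Qed.

Lemma fractional_regular (I : set Q) : fractional_ideal iota I ->
  exists2 a, GRing.lreg a & I (iota a).
Proof.
case=> [[_ _ IM]] [x Ix regx] _.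
case: frac => _ _ /(_ x)[a [b [regb xE]]].
have xb : x * iota b = iota a by rewrite xE divrK // iota_unit.
exists a; first exact: lreg_numerator xb.
by rewrite -xb mulrC; apply: IM.
Qed.

Lemma fractional_colon (K I : set Q) : fractional_ideal iota K ->
  fractional_ideal iota I -> fractional_ideal iota (colon K I).
Proof.
move=> fracK fracI.
have [k regk Kk] := fractional_regular fracK.
have [a rega Ia] := fractional_regular fracI.
have [[K0 KD KM] _ [g regg gK]] := fracK.
have [_ _ [h regh hI]] := fracI.
split; first split=> [x _|x y Kx Ky z Iz|r x Kx z Iz].
- by rewrite mul0r.
- by rewrite mulrDl; apply: KD; [apply: Kx|apply: Ky].
- by rewrite -mulrA; apply: KM; apply: Kx.
- exists (iota (k * h)); last first.
    by apply: mulrI; apply: iota_unit; apply: lregM.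
  move=> x Ix; rewrite rmorphM -mulrA.
  by have [r _ <-] := hI x Ix; rewrite mulrC; apply: KM.
- exists (g * a); first exact: lregM.
  by move=> x Kx; rewrite rmorphM -mulrA [iota a * x]mulrC; apply/gK/Kx.
Qed.

Lemma fractional_add (I J : set Q) :
  fractional_ideal iota I -> fractional_ideal iota J ->
  fractional_ideal iota [set x + y | x in I & y in J].
Proof.
move=> [[I0 ID IM] [x Ix regx] [g regg gI]] [[J0 JD JM] _ [h regh hJ]].
split; first split.
- by exists 0 => //; exists 0 => //; rewrite addr0.
- move=> _ _ [y Iy [z Jz <-]] [y' Iy' [z' Jz' <-]].
  by exists (y + y'); [apply: ID|exists (z + z'); [apply: JD|rewrite addrACA]].
- move=> r _ [y Iy [z Jz <-]].
  exists (iota r * y); first exact: IM.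
  by exists (iota r * z); [apply: JM|rewrite mulrDr].
- by exists x => //; exists x => //; exists 0 => //; rewrite addr0.
- exists (g * h); first exact: lregM.
  move=> _ [y Iy [z Jz <-]].
  have [s _ gy] := gI y Iy; have [t _ hz] := hJ z Jz.
  exists (h * s + g * t) => //.
  by rewrite rmorphD !rmorphM gy hz mulrDr mulrA [iota h * _]mulrC !mulrA.
Qed.

(** The dual of a sum is the intersection of the duals. Applied to the duals of [I] and [J] this
    gives [I] and [J] back, and dualising once more yields the formula. *)
Lemma colon_cap (K I J : set Q) : canonical_ideal iota K ->
  fractional_ideal iota I -> fractional_ideal iota J ->
  colon K (I `&` J) = [set x + y | x in colon K I & y in colon K J].
Proof.
move=> [fracK dualK] fracI fracJ; set S := [set _ | _ in _ & _ in _].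
have fracKI := fractional_colon fracK fracI.
have fracKJ := fractional_colon fracK fracJ.
rewrite -(dualK S); last exact: fractional_add.
congr (colon K _); rewrite -{1}(dualK I) // -{1}(dualK J) //.
case: (fracK) => -[_ KD _] _ _; case: fracKI => -[KI0 _ _] _ _.
case: fracKJ => -[KJ0 _ _] _ _.
apply/seteqP; split=> [x [KIx KJx] _ [y KIy [z KJz <-]]|x Sx].
  by rewrite mulrDr; apply: KD; [apply: KIx|apply: KJx].
split=> y Ky; apply: Sx.
  by exists y => //; exists 0 => //; rewrite addr0.
by exists 0 => //; exists y => //; rewrite add0r.
Qed.

End FractionalIdeals.
(** * Valuations over a one-dimensional local ring *)

(** Pigeonhole with as many candidates as places: were each candidate excluded, choosing an
    excluding place would be an injective, hence onto, map, yet [l0] excludes nothing. *)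
Lemma exists_unexcluded (p : nat) (bad : 'I_p -> 'I_p -> Prop) (l0 : 'I_p) :
  (forall l a b, bad l a -> bad l b -> a = b) -> (forall a, ~ bad l0 a) ->
  exists a, forall l, ~ bad l a.
Proof.
move=> bad_inj bad0; apply: contrapT => noa.
have [f fbad] : {f : 'I_p -> 'I_p & forall a, bad (f a) a}.
  apply: (@choice _ _ (fun a l => bad l a)) => a.
  by apply: contrapT => na; apply: noa; exists a => l bl; apply: na; exists l.
have f_inj : injective f.
  by move=> a b fab; apply: (bad_inj (f a)) => //; rewrite fab.
have /codomP[a fa] := injF_onto f_inj l0.
by apply: (bad0 a); rewrite fa.
Qed.

Lemma exists_residues (R : comNzRingType) (m : idealr R) (p : nat) (T : Type)
    (D : set T) (f : 'I_p -> T) :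
  (D #<= [set: {ideal_quot m}])%card -> injective f -> (forall i, D (f i)) ->
  exists r : 'I_p -> R, forall a b, r a - r b \in m -> a = b.
Proof.
move=> /card_leP[g] f_inj fD.
pose h a : {ideal_quot m} := val (g (SigSub (mem_set (fD a)))).
exists (fun a => repr (h a)) => a b.
rewrite Quotient.idealrBE => /eqP; rewrite !reprK => /val_inj gab.
apply: f_inj; suff [] : SigSub (mem_set (fD a)) = SigSub (mem_set (fD b)) by [].
by apply: ('inj_g _ _ gab); rewrite inE.
Qed.

Section Valuations.
Variables (R : comNzRingType) (m : idealr R).
Variables (Q : comUnitRingType) (iota : {rmorphism R -> Q}).
Variables (p : nat) (v : 'I_p -> Q -> \bar int).
Hypotheses (frac : total_fractions iota) (locR : local_ring m).
Hypotheses (noethR : noetherian R) (dimR : krull_dim R 1).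
Hypothesis dv : forall i, discrete_valuation (v i).
Hypothesis v_ge0 : forall i r, (0%:E <= v i (iota r))%E.

Lemma val_notin i r : r \notin m -> v i (iota r) = 0%:E.
Proof.
move=> /(local_inv locR)[s rs]; apply/eqP; rewrite eq_le v_ge0 andbT.
have := valM (dv i) (iota r) (iota s).
rewrite -rmorphM rs rmorph1 (val1 (dv i)); have := v_ge0 i s.
case: (v i (iota s)) => [b||] //; last by case: (v i (iota r)).
case: (v i (iota r)) => [a||] // b0.
rewrite -EFinD => -[/esym/eqP]; rewrite addr_eq0 => /eqP ->.
by rewrite lee_fin oppr_le0 -lee_fin.
Qed.

(** A fraction of value -1 has a denominator of positive value. *)
Lemma center_regular i :
  exists2 b, GRing.lreg b & (0%:E < v i (iota b))%E.
Proof.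
have [x vx] := val_onto (dv i) (-1).
case: frac => _ _ /(_ x)[a [b [regb xE]]]; exists b => //.
have ub := iota_unit frac regb.
have [c vb] := val_unit (dv i) ub.
have := v_ge0 i a; have -> : iota a = x * iota b by rewrite xE divrK.
by rewrite (valME (dv i) vx vb) vb lt_EFinS !lee_fin addrC subr_ge0 add0r.
Qed.

Lemma center_prime i : prime_ideal [set r | (0%:E < v i (iota r))%E].
Proof.
split; first split=> //=.
- by rewrite rmorph0 (val0 (dv i)) ltry.
- by move=> x y x0 y0; rewrite rmorphD; apply: val_gtD.
- move=> a x _; rewrite !lt_EFinS rmorphM -[0 + 1]add0r => x1.
  exact: val_geM.
- move=> T; have : [set: R] 1 by [].
  by rewrite -T /= rmorph1 (val1 (dv i)) ltxx.
- move=> x y /=; rewrite rmorphM (valM (dv i)).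
  have := v_ge0 i x; rewrite le_eqVlt => /orP[/eqP <-|]; last by left.
  by rewrite add0e; right.
Qed.

(** The center of [v i] is a prime ideal containing a regular element, hence equals [m] in dimension
    one. *)
Lemma val_in i r : r \in m -> (0%:E < v i (iota r))%E.
Proof.
have [b regb vb] := center_regular i.
have centerE : [set r | (0%:E < v i (iota r))%E] = [set` m].
  apply: (krull_dim1_prime (b := b)) => //.
  - exact: local_maximal.
  - exact: center_prime.
  - move=> s /= vs; apply: contraT => /(val_notin i) s0.
    by rewrite s0 ltxx in vs.
by move=> mr; have : [set` m] r by []; rewrite -centerE.
Qed.

Lemma val_residue i r s : (0%:E < v i (iota r - iota s))%E -> r - s \in m.
Proof.
rewrite -rmorphB; apply: contraTT => /(val_notin i) ->.
by rewrite ltxx.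
Qed.

Variable i0 : 'I_p.

Lemma exists_uniformizer : exists b, [/\ GRing.lreg b, b \in m &
  forall i, (0%:E < v i (iota b))%E].
Proof.
have [b regb vb] := center_regular i0; exists b.
have mb : b \in m.
  by apply: contraTT vb => /(val_notin i0) ->; rewrite ltxx.
by split=> // i; apply: val_in.
Qed.

Lemma exists_regular_val_ge (f : 'I_p -> int) :
  exists2 c, GRing.lreg c & forall i, ((f i)%:E <= v i (iota c))%E.
Proof.
have [b [regb _ vb]] := exists_uniformizer.
(* Every value of [b] is at least 1, and the exponent dominates each [f i]. *)
exists (b ^+ (\sum_i `|f i|)%N) => [|i]; first exact: lregX.
have [c vc] := val_unit (dv i) (iota_unit frac regb).
rewrite rmorphXn (valXE (dv i) _ vc) lee_fin.
have c1 : 1 <= c by move: (vb i); rewrite vc lt_EFinS lee_fin add0r.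
apply: (le_trans (lez_abs _)).
apply: (@le_trans _ _ ((\sum_i `|f i|)%N : int)).
  by rewrite lez_nat (bigD1 i) //= leq_addr.
by rewrite -[X in X <= _]natz lerMn2r c1 orbT.
Qed.

(** If [x] had negative value, the leading term of its integral equation would have a value strictly
    below all others, and the sum could not vanish. *)
Lemma integral_val_ge0 x : integralOver iota x -> forall i, (0%:E <= v i x)%E.
Proof.
move=> [q monq /rootP qx] i; rewrite leNgt; apply/negP.
have [->|/eqP vx] := eqVneq (v i x) +oo%E => //.
have {vx} [a vx] := val_fin (dv i) vx; rewrite vx lte_fin => a0.
have monq' : map_poly iota q \is monic by rewrite monic_map.
have := horner_coef (map_poly iota q) x; rewrite qx.
case sq : (size _) => [|n].
  by move/eqP: sq; rewrite size_poly_eq0 (negPf (monic_neq0 monq')).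
rewrite big_ord_recr /=.
have -> : (map_poly iota q)`_n = 1.
  by rewrite -(monicP monq') /lead_coef sq.
rewrite mul1r addrC => /(congr1 (v i)).
rewrite (val0 (dv i)) (valD_lt (dv i) (valXE (dv i) n vx)) //.
rewrite lt_EFinS; apply: (val_ge_sum (dv i)) => k _.
rewrite coef_map -[_ + 1]add0r; apply: (val_geM (dv i)); first exact: v_ge0.
rewrite (valXE (dv i) _ vx) lee_fin.
move: (nat_of_ord k) (ltn_ord k) => {}k kn; rewrite -(subnK kn) addnS.
rewrite -addSn mulrnDr.
rewrite mulrS addrAC gerDr addrAC -[X in _ <= X]addr0.
by rewrite lerD ?mulrn_wle0 ?(ltW a0) // lezD1.
Qed.

Definition val_ge (f : 'I_p -> int) : set Q :=
  [set x | forall i, ((f i)%:E <= v i x)%E].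

Lemma val_geZ f r x : val_ge f x -> val_ge f (iota r * x).
Proof.
by move=> fx i; rewrite -[f i]add0r; apply: val_geM; [|exact: v_ge0|exact: fx].
Qed.

Lemma val_ge_submodule f : submodule iota (val_ge f).
Proof.
split; last exact: val_geZ.
- by move=> i; rewrite (val0 (dv i)) leey.
- by move=> x y fx fy i; apply: val_geD; [|apply: fx|apply: fy].
Qed.

(** * The conductor and elements with finite values *)

Variables (K : set Q) (gamma : {ffun 'I_p -> nat}).
Hypotheses (canK : canonical_ideal iota K) (condK : conductor iota v K gamma).

Let fracK : fractional_ideal iota K. Proof. by case: canK. Qed.

Let closed0 : integral_closure iota 0. Proof. exact: integral0. Qed.

Let closed1 : integral_closure iota 1. Proof. exact: integral1. Qed.

Lemma conductor_sub : val_ge (fun i => gamma i) `<=` K.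
Proof.
move=> x gx; have : conductor_ideal iota K x by rewrite condK.
by move=> /(_ 1 closed1); rewrite mulr1.
Qed.

Lemma val_infty_eq0 y : (forall i, v i y = +oo%E) -> y = 0.
Proof.
move=> vy; have [b [regb mb _]] := exists_uniformizer.
have ub := iota_unit frac regb.
have [_ _ [g regg gK]] := fracK.
(* All [y / iota b ^+ n] have infinite values, so they lie in the conductor, hence in [K], and [g]
   sends them into [R]. *)
have [s sE] : {s : nat -> R & forall n, iota (s n) = iota g * (y / iota b ^+ n)}.
  apply: (@choice _ _ (fun n s => iota s = iota g * (y / iota b ^+ n))) => n.
  have [|s _ <-] := gK (y / iota b ^+ n); last by exists s.
  by apply: conductor_sub => i; rewrite (valM_infty (dv i)) // leey.
have sS n : s n = b * s n.+1.
  apply: (iota_inj frac); rewrite rmorphM !sE [RHS]mulrCA; congr (_ * _).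
  by rewrite [RHS]mulrCA exprS invrM ?unitrX // [iota b * _]mulrCA mulrV // mulr1.
have := sE 0%N; rewrite (krull_intersection locR noethR mb sS) rmorph0 divr1.
by move/esym/eqP; rewrite (mulrI_eq0 _ (mulrI (iota_unit frac regg))) => /eqP.
Qed.

(** An element killed by [x] has only infinite values, hence is zero; so [x] is regular. *)
Lemma val_finite_unit x : (forall i, exists a, v i x = a%:E) ->
  x \is a GRing.unit.
Proof.
move=> vx; apply: (lreg_unit frac); apply: mulrI0_lreg => y xy0.
apply: val_infty_eq0 => i; have [a va] := vx i.
have := valM (dv i) x y; rewrite xy0 (val0 (dv i)) va.
by have := @val_neqNy _ _ (dv i) y; case: (v i y).
Qed.

Lemma val_ge_bounded f (I : set Q) : I `<=` val_ge f ->
  exists2 g : R, GRing.lreg g & forall x, I x -> range iota (iota g * x).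
Proof.
move=> If; have [_ _ [g regg gK]] := fracK.
(* Multiplying by [c] lifts the values from [f] to [gamma], which leads into [K]. *)
have [c regc vc] := exists_regular_val_ge (fun i => (gamma i)%:Z - f i).
exists (g * c) => [|x Ix]; first exact: lregM.
rewrite rmorphM -mulrA; apply/gK/conductor_sub => i.
by rewrite -[X in X%:E](subrK (f i)); apply: val_geM => //; apply: If.
Qed.

Lemma val_ge_fractional f : fractional_ideal iota (val_ge f).
Proof.
split; first exact: val_ge_submodule; last exact: (@val_ge_bounded f).
have [c regc vc] := exists_regular_val_ge f.
by exists (iota c) => //; apply/mulrI/(iota_unit frac).
Qed.

Lemma integral_closureE : integral_closure iota = val_ge (fun=> 0).
Proof.
have [_ dualK] := canK; apply/seteqP; split.
  by move=> x ix i; apply: integral_val_ge0.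
rewrite -(dualK (integral_closure iota)); last first.
  split; first split=> [//|x y|s x].
  - exact: integral_add.
  - by apply: integral_mul; apply: integral_id.
  - by exists 1 => //; apply: lreg1.
  - by apply: (@val_ge_bounded (fun=> 0)) => x ix i; apply: integral_val_ge0.
(* After double duality, [x] only has to multiply the conductor into [K]; a nonnegative value keeps
   values above [gamma]. *)
move=> x x0; rewrite -/(conductor_ideal iota K) condK => y gy.
apply: conductor_sub => i.
by rewrite -[X in X%:E]add0r; apply: val_geM => //; apply: x0.
Qed.

(** Removes infinite values without touching finite ones. The correction is an [R]-multiple of [h],
    so a submodule containing [x] and [h] also contains the sum. *)
Lemma exists_perturbation (h x : Q) (f : 'I_p -> int) :
  h \is a GRing.unit -> exists r, let y := iota r * h in
  [/\ x + y \is a GRing.unit, val_ge f y &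
      forall i a, v i x = a%:E -> v i (x + y) = a%:E].
Proof.
move=> uh; have [eh hE] : {eh : 'I_p -> int & forall i, v i h = (eh i)%:E}.
  by apply: (@choice _ _ (fun i a => v i h = a%:E)) => i; apply: (val_unit (dv i)).
(* At an infinite value [fine] returns 0, which is harmless: only finite values have to be
   exceeded. *)
pose f' i := Num.max (f i) (fine (v i x) + 1).
have [c regc vc] := exists_regular_val_ge (fun i => f' i - eh i).
have vy i : ((f' i)%:E <= v i (iota c * h))%E.
  by rewrite -[f' i](subrK (eh i)); apply: val_geM => //; rewrite hE.
have xy i a : v i x = a%:E -> v i (x + iota c * h) = a%:E.
  move=> vx; apply: (valD_lt (dv i)) => //; rewrite lt_EFinS.
  by apply: le_trans (vy i); rewrite lee_fin le_max vx /= lexx orbT.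
exists c; split=> // [|i]; last first.
  by apply: le_trans (vy i); rewrite lee_fin le_max lexx.
apply: val_finite_unit => i.
have [vx|/eqP vx] := eqVneq (v i x) +oo%E; last first.
  by have [a vxa] := val_fin (dv i) vx; exists a; apply: xy.
have [a va] : exists a, v i (iota c * h) = a%:E.
  by apply: (val_unit (dv i)); rewrite unitrM uh iota_unit.
by exists a; rewrite addrC; apply: (valD_lt (dv i)) => //; rewrite vx ltry.
Qed.

Lemma horner_val_ge0 x (q : {poly R}) : val_ge (fun=> 0) x ->
  val_ge (fun=> 0) (map_poly iota q).[x].
Proof.
move=> x0 i; elim/poly_ind: q => [|q c IHq].
  by rewrite rmorph0 horner0 (val0 (dv i)) leey.
rewrite rmorphD rmorphM /= map_polyX map_polyC hornerMXaddC.
apply: (val_geD (dv i)); last exact: v_ge0.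
by rewrite -[X in X%:E]add0r; apply: (val_geM (dv i)) => //; apply: x0.
Qed.

(** * Residues at the centers of the valuations *)

Hypothesis resQ : residually_rational iota.

(* The residue field of v i is integral over that of R, hence every element of
   valuation 0 is invertible modulo the center of v i. *)
Lemma center_maximal i : maximal_ideal (integral_closure iota)
  [set x | val_ge (fun=> 0) x /\ (0%:E < v i x)%E].
Proof.
set n := [set x | _ /\ _]; have VE := integral_closureE.
have V0 : val_ge (fun=> 0) 0 by rewrite -VE; exact: integral0.
have V1 : val_ge (fun=> 0) 1 by rewrite -VE; exact: integral1.
have VD x y : val_ge (fun=> 0) x -> val_ge (fun=> 0) y -> val_ge (fun=> 0) (x + y).
  by rewrite -VE; apply: integral_add.
have VM x y : val_ge (fun=> 0) x -> val_ge (fun=> 0) y -> val_ge (fun=> 0) (x * y).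
  by rewrite -VE; apply: integral_mul.
have VR r : val_ge (fun=> 0) (iota r) by rewrite -VE; apply: integral_id.
rewrite VE; split; first split.
- by move=> x [].
- by split=> //; rewrite (val0 (dv i)) ltry.
- move=> x y [Vx x0] [Vy y0]; split; first exact: VD.
  exact: (val_gtD (dv i)).
- move=> a x Va [Vx x0]; split; first exact: VM.
  rewrite lt_EFinS -[X in X%:E](add0r); apply: (val_geM (dv i)); first exact: Va.
  by rewrite -lt_EFinS.
- move=> nV; have : val_ge (fun=> 0) 1 by [].
  by rewrite -nV => -[_]; rewrite (val1 (dv i)) ltxx.
move=> J [JV J0 JD JM] nJ.
suff unitJ x : J x -> ~ n x -> J 1.
  have [Jn|/existsNP[x /not_implyP[Jx nx]]] := pselect (J `<=` n).
    by left; apply/seteqP.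
  right; apply/seteqP; split=> // y Vy; rewrite -[y]mulr1.
  by apply: JM => //; apply: unitJ nx.
move=> Jx nx; have Vx := JV _ Jx.
have x0 : v i x = 0%:E.
  apply/eqP; rewrite eq_le [X in _ && X]Vx andbT leNgt.
  by apply/negP => x0; apply: nx.
have JB y z : J y -> J z -> J (y - z).
  move=> Jy Jz; apply: JD => //; rewrite -mulN1r -(rmorph1 iota) -rmorphN.
  exact: JM.
have [q monq /rootP qx] : integralOver iota x.
  by have : integral_closure iota x by rewrite VE.
(* Induction on a polynomial with a coefficient outside [m] and positive value at [x]. If its
   constant term is outside [m], that term is a unit of [R] lying in [J]; otherwise drop it and
   divide by [x], which has value 0. *)
have : exists k, q`_k \notin m.
  by exists (size q).-1; rewrite [q`__](monicP monq) idealr1.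
have : (0%:E < v i (map_poly iota q).[x])%E by rewrite qx (val0 (dv i)) ltry.
elim/poly_ind: q {monq qx} => [|q c IHq].
  by move=> _ [k]; rewrite coef0 rpred0.
have Vqx := horner_val_ge0 q Vx.
rewrite rmorphD rmorphM /= map_polyX map_polyC hornerMXaddC => qc0 [k].
have [mc|nmc] := boolP (c \in m); last first.
  have [s cs] := local_inv locR nmc => _.
  rewrite -(rmorph1 iota) -cs mulrC rmorphM; apply: (JM); first exact: VR.
  rewrite -[iota c](addKr ((map_poly iota q).[x] * x)) addrC; apply: JB.
    by apply: nJ; split=> //; apply: VD => //; apply: VM.
  exact: JM.
rewrite coefD coefMX coefC; case: k => [|k] /=; first by rewrite add0r mc.
rewrite addr0 => qk; apply: IHq; last by exists k.
have := val_gtB (dv i) qc0 (val_in i mc).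
by rewrite addrK (valM (dv i)) x0 adde0.
Qed.

Lemma exists_residue i x : val_ge (fun=> 0) x ->
  exists r, (0%:E < v i (x - iota r))%E.
Proof.
rewrite -integral_closureE => ix.
by have [r [_ xr]] := resQ (center_maximal i) ix; exists r.
Qed.

(** * Independence of the valuations *)

Hypothesis v_inj : forall i j,
  valuation_ring (v i) = valuation_ring (v j) -> i = j.

(** Otherwise, on units, nonnegativity at [i] would imply it at [j]; this forces the two valuation
    rings to coincide. *)
Lemma exists_separating_unit i j : i != j ->
  exists x, [/\ x \is a GRing.unit, (0%:E <= v i x)%E & (v j x < 0%:E)%E].
Proof.
apply: contra_neqP => noij; apply: v_inj.
have sub_unit x : x \is a GRing.unit -> (0%:E <= v i x)%E -> (0%:E <= v j x)%E.
  by move=> ux x0; rewrite leNgt; apply/negP => xj; apply: noij; exists x.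
have [b [regb _ vb]] := exists_uniformizer.
have ub := iota_unit frac regb.
apply/seteqP; split=> x; rewrite /valuation_ring /=.
  move=> x0; have [r [uxy y0 _]] := exists_perturbation x (fun=> 0) (unitr1 _).
  rewrite -(addrK (iota r * 1) x); apply: (val_geB (dv j)); last exact: y0.
  by apply: sub_unit => //; apply: (val_geD (dv i)) => //; apply: y0.
move=> xj; rewrite leNgt; apply/negP => xi.
have [a va] : exists a, v i x = a%:E.
  by apply: (val_fin (dv i)) => vx; rewrite vx in xi.
have [r [uxy y0 xyE]] := exists_perturbation x (fun=> 0) (unitr1 _).
set z := x + _ in uxy xyE; have zi := xyE _ _ va.
have zj : (0%:E <= v j z)%E by apply: (val_geD (dv j)) => //; apply: y0.
have [c vzj] := val_unit (dv j) uxy; rewrite vzj lee_fin in zj.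
have [e vbi] := val_unit (dv i) ub; have [f vbj] := val_unit (dv j) ub.
have e0 : 0 < e by have := vb i; rewrite vbi lte_fin.
have f0 : 0 < f by have := vb j; rewrite vbj lte_fin.
rewrite va lte_fin in xi.
(* As [z] has value at most -1 at [i], the power [e] cancels the value of [b] there, while at [j]
   the product stays positive. Its inverse contradicts [sub_unit]. *)
have uzb : z ^+ `|e|%N * iota b \is a GRing.unit by rewrite unitrM unitrX.
have := sub_unit (z ^+ `|e|%N * iota b)^-1; rewrite unitrV => /(_ uzb).
rewrite (valV (dv i) uzb (valME (dv i) (valXE (dv i) _ zi) vbi)).
rewrite (valV (dv j) uzb (valME (dv j) (valXE (dv j) _ vzj) vbj)).
rewrite !lee_fin !oppr_ge0 => le_imp.
have : a *+ `|e| + e <= 0.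
  have eE : e = 1 *+ `|e|%N :> int by rewrite natz gtz0_abs.
  by rewrite [X in _ + X]eE -mulrnDl mulrn_wle0 // lezD1.
by move/le_imp; rewrite leNgt ltr_wpDl // mulrn_wge0.
Qed.

Variable r : 'I_p -> R.
Hypothesis r_inj : forall a b, r a - r b \in m -> a = b.

(* If x is not integral at j, some residue c avoids x at every other place; then
   (x - c)^-1 is integral, vanishes at j, and is a unit wherever x is integral. *)
Lemma exists_separating_integer i j : i != j ->
  exists x, [/\ val_ge (fun=> 0) x, v i x = 0%:E & (0%:E < v j x)%E].
Proof.
move=> /exists_separating_unit[x [ux xi xj]].
(* The place [j] is the free one: subtracting a residue leaves the negative value there
   unchanged. *)
have [|a|a good] :=
  @exists_unexcluded p (fun l a => 0%:E < v l (x - iota (r a)))%E j.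
- move=> l a b xa xb; apply: r_inj; apply: (@val_residue l).
  have := val_gtB (dv l) xb xa.
  by rewrite opprB [_ + (_ - _)]addrC addrA subrK.
- apply/negP; rewrite -leNgt; apply: ltW; apply: (le_lt_trans _ xj).
  have [c vc] := val_unit (dv j) ux; rewrite vc lte_fin in xj.
  rewrite (valD_lt (dv j) vc) ?vc // valN //.
  by apply: lt_le_trans (v_ge0 _ _); rewrite lte_fin.
pose z := x - iota (r a).
have z_ge0 l : (0%:E <= v l x)%E -> v l z = 0%:E.
  move=> x0; apply/eqP; rewrite eq_le leNgt (introN idP (good l)) /=.
  by apply: (val_geB (dv l)) => //; apply: v_ge0.
have z_lt0 l : (v l x < 0%:E)%E -> v l z = v l x.
  have [c vc] := val_unit (dv l) ux; rewrite vc lte_fin => c0.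
  rewrite (valD_lt (dv l) vc) ?vc // valN //.
  by apply: lt_le_trans (v_ge0 _ _); rewrite lte_fin.
have uz : z \is a GRing.unit.
  apply: val_finite_unit => l; have [x0|x0] := leP 0%:E (v l x).
    by exists 0; apply: z_ge0.
  by rewrite z_lt0 //; apply: val_unit.
exists z^-1; split=> [l||].
- have [x0|x0] := leP 0%:E (v l x).
    by rewrite (valV (dv l) uz (z_ge0 l x0)) oppr0.
  have [c vc] := val_unit (dv l) ux.
  rewrite (valV (dv l) uz (etrans (z_lt0 l x0) vc)).
  by move: x0; rewrite vc lte_fin lee_fin oppr_ge0 => /ltW.
- by rewrite (valV (dv i) uz (z_ge0 i xi)) oppr0.
- have [c vc] := val_unit (dv j) ux.
  rewrite (valV (dv j) uz (etrans (z_lt0 j xj) vc)).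
  by move: xj; rewrite vc !lte_fin oppr_gt0.
Qed.

Lemma exists_idempotent_lift i : exists x,
  [/\ val_ge (fun=> 0) x, v i x = 0%:E & forall j, j != i -> (0%:E < v j x)%E].
Proof.
have [y yP] : {y : 'I_p -> Q & forall j, j != i ->
    [/\ val_ge (fun=> 0) (y j), v i (y j) = 0%:E & (0%:E < v j (y j))%E]}.
  apply: (@choice _ _ (fun j x => j != i -> [/\ val_ge (fun=> 0) x,
    v i x = 0%:E & (0%:E < v j x)%E])) => j.
  have [->|ij] := eqVneq j i; first by exists 0.
  rewrite eq_sym in ij; have [x] := exists_separating_integer ij.
  by exists x.
exists (\prod_(j | j != i) y j); split=> [l||j ji].
- by apply: (val_prod_ge0 (dv l)) => j /yP[+ _ _].
- by apply: (val_prod_eq0 (dv i)) => j /yP[].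
rewrite (bigD1 j) //= lt_EFinS addrC; apply: (val_geM (dv j)).
  by have [_ _] := yP j ji; rewrite lt_EFinS add0r.
by apply: (val_prod_ge0 (dv j)) => l /andP[/yP[+ _ _] _].
Qed.

(** Add an element [t'] of value 1 at [i] and positive elsewhere to the square of some [w], positive
    at [i] and of value 0 elsewhere. *)
Lemma exists_local_parameter i : exists2 x, x \is a GRing.unit &
  v i x = 1%:E /\ forall j, j != i -> v j x = 0%:E.
Proof.
have [u uP] := @choice _ _ (fun i x => [/\ val_ge (fun=> 0) x, v i x = 0%:E &
  forall j, j != i -> (0%:E < v j x)%E]) exists_idempotent_lift.
have [t0 vt0] := val_onto (dv i) 1.
have [s [ut _ /(_ i _ vt0)]] := exists_perturbation t0 (fun=> 0) (unitr1 _).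
set t := t0 + _ in ut * => vt {vt0}.
have [e vte] : {e : 'I_p -> int & forall j, v j t = (e j)%:E}.
  by apply: (@choice _ _ (fun j a => v j t = a%:E)) => j; apply: (val_unit (dv j)).
(* The exponent [M] exceeds every [|e j|], so that [u i ^+ M] outweighs any pole of [t] away from
   [i]. *)
pose M := (\sum_j `|e j|%N).+1; pose t' := t * u i ^+ M.
have t'i : v i t' = 1%:E.
  have [_ ui _] := uP i.
  by rewrite (valME (dv i) vt (valXE (dv i) M ui)) mul0rn addr0.
have t'j j : j != i -> (0%:E < v j t')%E.
  move=> ji; have [_ _ /(_ j ji) uij] := uP i.
  rewrite /t' (valM (dv j)) vte; case E : (v j (u i)) => [a||].
  - have a1 : 1 <= a by move: uij; rewrite E lt_EFinS lee_fin.
    rewrite (valXE (dv j) M E) -EFinD lte_fin.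
    apply: (@lt_le_trans _ _ (e j + (M : int))); last first.
      by rewrite lerD2l -[X in X <= _]natz lerMn2r a1 orbT.
    rewrite /M -addn1 PoszD addrA ltzD1 -lerBlDl sub0r.
    apply: (le_trans (lez_abs _)); rewrite abszN lez_nat.
    by rewrite (bigD1 j) //= leq_addr.
  - by rewrite /M exprS (valM_infty (dv j)).
  - by rewrite E in uij.
pose w := \sum_(j | j != i) u j.
have wi : (1%:E <= v i w)%E.
  apply: (val_ge_sum (dv i)) => j ji; have [_ _ uj] := uP j.
  by rewrite -[1]add0r -lt_EFinS uj // eq_sym.
have wj j : j != i -> v j w = 0%:E.
  move=> ji; rewrite /w (bigD1 j) //=; have [_ uj _] := uP j.
  apply: (valD_lt (dv j)) => //; rewrite lt_EFinS.
  apply: (val_ge_sum (dv j)) => l /andP[_ lj]; have [_ _ ul] := uP l.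
  by rewrite -lt_EFinS ul // eq_sym.
(* The square has value at least 2 at [i]; [w] alone could interfere with [t']. *)
have xi : v i (t' + w * w) = 1%:E.
  by apply: (valD_lt (dv i)) => //; rewrite lt_EFinS; apply: (val_geM (dv i)).
have xj j : j != i -> v j (t' + w * w) = 0%:E.
  move=> ji; rewrite addrC; apply: (valD_lt (dv j)); last exact: t'j.
  by rewrite (valME (dv j) (wj j ji) (wj j ji)).
exists (t' + w * w) => //; apply: val_finite_unit => j.
by have [->|/xj ->] := eqVneq j i; [exists 1|exists 0].
Qed.

Lemma exists_unit_val (f : 'I_p -> int) :
  exists2 x, x \is a GRing.unit & forall i, v i x = (f i)%:E.
Proof.
have [t tP] : {t : 'I_p -> Q & forall i, [/\ t i \is a GRing.unit, v i (t i) = 1%:E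
    & forall j, j != i -> v j (t i) = 0%:E]}.
  apply: (@choice _ _ (fun i x => [/\ x \is a GRing.unit, v i x = 1%:E &
    forall j, j != i -> v j x = 0%:E])) => i.
  by have [x ux [xi xj]] := exists_local_parameter i; exists x.
have valz j x a n : x \is a GRing.unit -> v j x = a%:E ->
    v j (x ^ n) = (a * n)%:E.
  move=> ux vx; case: n => n.
    by rewrite -exprnP (valXE (dv j) n vx) -mulr_natr natz.
  rewrite [x ^ _]/= (valV (dv j) (unitrX _ ux) (valXE (dv j) _ vx)) NegzE.
  by rewrite -mulr_natr natz mulrN.
exists (\prod_i t i ^ f i) => [|j].
  by apply: rpred_prod => i _; have [ui _ _] := tP i; apply: unitrXz.
rewrite (bigD1 j) //= (valM (dv j)).
have [uj vj _] := tP j; rewrite (valz j _ _ _ uj vj) mul1r.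
rewrite (val_prod_eq0 (dv j)) ?adde0 // => i ij.
by have [ui _ vi] := tP i; rewrite (valz j _ 0 _ ui) ?mul0r // vi // eq_sym.
Qed.

(** * Duality in terms of values *)

Lemma colon_val_ge (f : 'I_p -> int) :
  colon K (val_ge f) = val_ge (fun i => (gamma i)%:Z - f i).
Proof.
(* Through [u] the set [val_ge f] is a translate of the integral closure, and its dual a translate
   of the conductor. *)
have [u uu vu] := exists_unit_val f.
apply/seteqP; split=> y.
  move=> Ky i; have : conductor_ideal iota K (y * u).
    move=> z; rewrite integral_closureE -mulrA => z0; apply: Ky => l.
    by rewrite -[f l]addr0; apply: (val_geM (dv l)) => //; rewrite vu.
  rewrite condK => /(_ i); rewrite (valM (dv i)) vu.
  by case: (v i y) => [a||] //=; rewrite ?leey // !lee_fin lerBlDr.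
move=> yf x xf; apply: conductor_sub => i.
by rewrite -[(gamma i)%:Z](subrK (f i)); apply: (val_geM (dv i)).
Qed.

(* An element of K at gamma - e_i would force every x >= gamma - e_i into K, so
   that gamma would not be the conductor. *)
Lemma no_val_below_conductor i z : K z -> v i z = ((gamma i)%:Z - 1)%:E ->
  (forall j, j != i -> (((gamma j)%:Z)%:E <= v j z)%E) -> False.
Proof.
move=> Kz vzi vzj.
pose f j := (gamma j)%:Z - (j == i)%:Z.
have fz : val_ge f z.
  move=> j; rewrite /f; have [->|/vzj] := eqVneq j i; first by rewrite vzi.
  by rewrite subr0.
suff fK : val_ge f `<=` K.
  have : conductor_ideal iota K z.
    move=> x; rewrite integral_closureE => x0; apply: fK => j.
    by rewrite -[f j]addr0; apply: (val_geM (dv j)).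
  rewrite condK => /(_ i); rewrite vzi lee_fin leNgt.
  by rewrite gtrBl ltr01.
move=> x fx; have [u uu vu] := exists_unit_val f.
have div_ge0 y : val_ge f y -> val_ge (fun=> 0) (y / u).
  move=> fy j; rewrite -(subrr (f j)); apply: (val_geM (dv j)) => //.
  by rewrite (valV (dv j) uu (vu j)).
have [a xa] := exists_residue i (div_ge0 x fx).
have [b zb] := exists_residue i (div_ge0 z fz).
(* Since [z / u] has value exactly 0 at [i], its residue [b] is invertible; subtracting [a / b]
   times [z] from [x] raises the value at [i] up to [gamma i]. *)
have nmb : b \notin m.
  apply/negP => /(val_in i) b0; have := val_gtD (dv i) zb b0.
  rewrite subrK (valME (dv i) vzi (valV (dv i) uu (vu i))).
  by rewrite /f eqxx subrr ltxx.
have [s bs] := local_inv locR nmb.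
have -> : x = (x - iota (a * s) * z) + iota (a * s) * z by rewrite subrK.
have [[_ KD KM] _ _] := fracK; apply: KD; last exact: KM.
apply: conductor_sub => j; have [->|ji] := eqVneq j i; last first.
  have fj : f j = gamma j by rewrite /f (negPf ji) subr0.
  rewrite -fj; apply: (val_geB (dv j)); first exact: fx.
  exact: (val_geZ (a * s) fz).
have -> : x - iota (a * s) * z =
    u * ((x / u - iota a) - iota (a * s) * (z / u - iota b)).
  rewrite [iota (a * s) * (_ - _)]mulrBr -rmorphM -mulrA [s * b]mulrC bs mulr1.
  rewrite opprB addrA subrK mulrBr [u * (x / u)]mulrCA mulrV // mulr1.
  by rewrite [u * (_ * _)]mulrCA [u * (z / u)]mulrCA mulrV // mulr1.
have fi : f i + 1 = gamma i by rewrite /f eqxx subrK.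
rewrite -fi; apply: (val_geM (dv i)); first by rewrite vu.
rewrite -[1]add0r -lt_EFinS; apply: (val_gtB (dv i)) => //.
rewrite lt_EFinS -[0 + 1]add0r; apply: (val_geM (dv i)); first exact: v_ge0.
by rewrite -lt_EFinS.
Qed.

Section Duality.
Variable I : set Q.
Hypothesis fracI : fractional_ideal iota I.

Lemma dual_values (f : 'I_p -> int) i :
  (forall x, I x -> val_ge f x -> v i x <> (f i)%:E) ->
  exists y, [/\ colon K I y, v i y = ((gamma i)%:Z - 1 - f i)%:E &
    forall j, j != i -> (((gamma j)%:Z - f j)%:E <= v j y)%E].
Proof.
move=> nox; pose f' j := f j + (j == i)%:Z.
have capE : I `&` val_ge f = I `&` val_ge f'.
  apply/seteqP; split=> x [Ix fx]; split=> // j; last first.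
    by apply: le_trans (fx j); rewrite lee_fin lerDl.
  rewrite /f'; have [->|ji] := eqVneq j i; last by rewrite addr0.
  rewrite -lt_EFinS lt_neqAle fx andbT eq_sym.
  exact/eqP/nox.
have := congr1 (colon K) capE.
rewrite !(colon_cap frac canK fracI (val_ge_fractional _)) !colon_val_ge => sumE.
(* [w] attains the bounds of the dual for [f']. In its decomposition [y + z], the part [z] has
   larger value at [i], so [y] inherits the value of [w] there. *)
have [w uw vw] := exists_unit_val (fun j => (gamma j)%:Z - f' j).
have [KI0 _ _] : submodule iota (colon K I).
  by have [] := fractional_colon frac fracK fracI.
have : [set x + y | x in colon K I & y in val_ge (fun i => (gamma i)%:Z - f i)] w.
  rewrite sumE; exists 0 => //; exists w; last by rewrite add0r.
  by move=> j; rewrite vw.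
move=> [y KIy [z zf wE]]; have yE : y = w - z by rewrite -wE addrK.
exists y; split=> // [|j ji]; rewrite yE.
  rewrite (valD_lt (dv i) (vw i)) ?valN // /f' ?eqxx.
    by rewrite opprD addrA addrAC.
  by apply: lt_le_trans (zf i); rewrite lte_fin ltrD2l ltrN2 ltrDl.
apply: (val_geB (dv j)); last exact: zf.
by rewrite vw /f' (negPf ji) addr0.
Qed.

Lemma no_complementary_values x y i (f : 'I_p -> int) : I x -> colon K I y ->
  v i x = (f i)%:E -> v i y = ((gamma i)%:Z - 1 - f i)%:E ->
  (forall j, j != i -> exists a b, [/\ (a%:E <= v j x)%E, (b%:E <= v j y)%E &
     (gamma j)%:Z <= a + b]) -> False.
Proof.
move=> Ix KIy vx vy xy; apply: (@no_val_below_conductor i (y * x)).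
- exact: KIy.
- by rewrite (valME (dv i) vy vx) subrK.
move=> j /xy[a [b [ax bx ab]]]; rewrite mulrC.
by apply: le_trans (val_geM (dv j) ax bx); rewrite lee_fin.
Qed.

End Duality.

(** Induction on [s]: if neither [x], minimal on the tail, nor [y], minimal at the head, serves for
    both, some [x + iota (r a) * y] does. *)
Lemma exists_common_minimum (M : set Q) (f : 'I_p -> int) (s : seq 'I_p) :
  submodule iota M -> s != [::] ->
  (forall i, i \in s -> exists x, [/\ M x, val_ge f x & v i x = (f i)%:E]) ->
  exists x, [/\ M x, val_ge f x & forall i, i \in s -> v i x = (f i)%:E].
Proof.
move=> [M0 MD MM]; elim: s => [//|j s IHs] _ Ms.
have [y [My fy vy]] := Ms j (mem_head j s).
have [s0|sN0] := eqVneq s [::].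
  by exists y; split=> // i; rewrite s0 inE => /eqP ->.
have {IHs} [|x [Mx fx vx]] := IHs sN0.
  by move=> i si; apply: Ms; rewrite inE si orbT.
have [ally|/existsNP[l0 /not_implyP[sl0 yl0]]] :=
    pselect (forall i, i \in s -> v i y = (f i)%:E).
  by exists y; split=> // i; rewrite inE => /orP[/eqP ->|/ally].
have [xj|xj] := eqVneq (v j x) (f j)%:E.
  by exists x; split=> // i; rewrite inE => /orP[/eqP ->|/vx].
have {}yl0 : ((f l0)%:E < v l0 y)%E.
  by rewrite lt_neqAle fy andbT eq_sym; apply/eqP.
have {}xj : ((f j)%:E < v j x)%E by rewrite lt_neqAle fx andbT eq_sym.
have fxy a : val_ge f (x + iota (r a) * y).
  move=> i; apply: (val_geD (dv i)); first exact: fx.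
  exact: (val_geZ (r a) fy).
have gtZ i c z : ((f i)%:E < v i z -> (f i)%:E < v i (iota c * z))%E.
  rewrite !lt_EFinS => z1; rewrite -[f i + 1]add0r.
  by apply: (val_geM (dv i)) => //; apply: v_ge0.
(* Two residues excluded at the same [l] would make both [x] and [y] exceed [f l] there, against the
   choice of one of them. At [l0] only [y] exceeds, so nothing is excluded. *)
have [|a|a good] := @exists_unexcluded p
  (fun l a => l \in j :: s /\ ((f l)%:E < v l (x + iota (r a) * y))%E) l0.
- move=> l a b [sl xa] [_ xb]; apply: r_inj; apply: contraT => /(val_notin l).
  have := val_gtB (dv l) xa xb.
  rewrite opprD addrACA subrr add0r -mulrBl -rmorphB (valM (dv l)) => yl rab.
  move: yl; rewrite rab add0e => yl.
  have xl := val_gtB (dv l) xa (gtZ _ (r a) _ yl); rewrite addrK in xl.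
  move: sl; rewrite inE => /orP[/eqP lj|/vx vl].
    by rewrite lj vy ltxx in yl.
  by rewrite vl ltxx in xl.
- move=> [_]; rewrite (valD_lt (dv l0) (vx _ sl0)) ?ltxx //.
  exact: gtZ.
exists (x + iota (r a) * y); split=> //; first by apply: MD => //; apply: MM.
move=> i si; apply/eqP; rewrite eq_le [X in _ && X]fxy andbT leNgt.
by apply/negP => gti; apply: (good i).
Qed.

(** [Delta_set] only sees regular elements with finite values; a perturbation makes infinite values
    finite while keeping them above [alpha]. *)
Lemma values_Delta (I : set Q) (alpha : {ffun 'I_p -> int}) (J : {set 'I_p}) x :
  fractional_ideal iota I -> I x ->
  (forall j, if j \in J then v j x = (alpha j)%:E else ((alpha j)%:E < v j x)%E) ->
  Delta_set v J alpha I !=set0.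
Proof.
move=> [[_ ID IM] [h Ih regh] _] Ix vx.
have [s [uxy yf xyE]] :=
  exists_perturbation x (fun i => alpha i + 1) (lreg_unit frac regh).
set y := iota s * h in uxy yf xyE.
have [e eE] : {e : 'I_p -> int & forall i, v i (x + y) = (e i)%:E}.
  by apply: (@choice _ _ (fun i a => v i (x + y) = a%:E)) => i; apply: (val_unit (dv i)).
exists [ffun i => e i]; split.
  exists (x + y); split=> [||i]; last by rewrite ffunE.
    by apply: ID => //; apply: IM.
  exact: mulrI.
move=> j; have := vx j; rewrite ffunE; case: ifP => _ vxj.
  by have := xyE _ _ vxj; rewrite eE => -[].
rewrite -lte_fin -eE; apply: (val_gtD (dv j)) => //.
by rewrite lt_EFinS; apply: yf.
Qed.

(** * Absolute maximals of the dual against relative maximals *)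

Lemma absolute_maximal_dual (I : set Q) (alpha beta : {ffun 'I_p -> int}) :
  fractional_ideal iota I -> values v I alpha -> values v (colon K I) beta ->
  (forall i, alpha i + beta i = (gamma i)%:Z - 1) ->
  absolute_maximal v beta (colon K I) <-> relative_maximal v alpha I.
Proof.
move=> fracI valpha vbeta ab.
have betaE i : beta i = (gamma i)%:Z - 1 - alpha i by rewrite -ab addrC addKr.
have gammaE i : (gamma i)%:Z = alpha i + beta i + 1 by rewrite ab subrK.
have fracKI := fractional_colon frac fracK fracI.
split=> [[_ absmax]|[_ _ relmax]]; [split=> // [|J J2]|split=> // J J0 JT].
- rewrite -subset0 => w [i _ [[x [Ix _ vx]] wi]].
  have [y [KIy _ vy]] := vbeta.
  apply: (no_complementary_values (f := alpha) (i := i) Ix KIy).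
  + by have := wi i; rewrite vx inE eqxx => ->.
  + by rewrite vy betaE.
  move=> j ji; exists (alpha j + 1), (beta j); split; last by rewrite gammaE addrAC.
    by rewrite vx lee_fin lezD1; have := wi j; rewrite inE (negPf ji).
  by rewrite vy.
- pose f j := alpha j + (j \notin J)%:Z.
  have fJ j : j \in J -> f j = alpha j by move=> Jj; rewrite /f Jj addr0.
  have fNJ j : j \notin J -> f j = alpha j + 1 by move=> Jj; rewrite /f Jj.
  have [subI _ _] := fracI.
  have [||x [Ix fx vx]] := @exists_common_minimum I f (enum J) subI.
  + by rewrite -size_eq0 -cardE -lt0n (ltn_trans _ J2).
  + move=> i; rewrite mem_enum => Ji; apply: contrapT => nox.
    have [|y [KIy yi yj]] := @dual_values I fracI f i.
      by move=> x Ix fx vx; apply: nox; exists x.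
    (* [y] is at least [beta] everywhere, with equality at [i] and strictly at any other element of
       [J], one of which exists as [J] has two elements. So [J'] is nonempty and proper, against
       absolute maximality. *)
    pose J' := [set j | v j y == (beta j)%:E]%SET.
    have J'i : i \in J' by rewrite inE yi fJ // -betaE.
    have [j Jj ji] : exists2 j, j \in J & j != i.
      have /card_gt0P[j] : (0 < #|J :\ i|)%N.
        by move: J2; rewrite (cardsD1 i) Ji.
      by rewrite in_setD1 => /andP[ji Jj]; exists j.
    have J'j : j \notin J'.
      rewrite inE; apply/eqP => vyj; have := yj j ji.
      by rewrite fJ // vyj lee_fin gammaE; lia.
    have := absmax J'; rewrite -subset0 => /(_ _ _)/=.
    have -> : (J' != finset.set0) by apply/set0Pn; exists i.
    have -> : (J' != [set: 'I_p]%SET).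
      by apply: contraNneq J'j => ->; rewrite inE.
    move=> /(_ isT isT) absJ'.
    have [|w /absJ'//] := @values_Delta _ beta J' y fracKI KIy.
    move=> l; rewrite inE; case: eqP => // /eqP yl; rewrite lt_neqAle eq_sym yl /=.
    have [li|/yj] := eqVneq l i; first by rewrite li yi fJ // -betaE.
    by apply: le_trans; rewrite lee_fin gammaE /f; case: (l \in J) => /=; lia.
  apply: (@values_Delta _ _ _ x) => // j; case: ifPn => Jj.
    by rewrite vx ?mem_enum // fJ.
  by rewrite lt_EFinS -fNJ.
- rewrite -subset0 => w [[y [KIy _ vy]] wJ].
  have /set0Pn[j Jj] := J0.
  have [l Jl] : exists l, l \notin J.
    apply/existsP; rewrite -negb_forall; apply: contraNN JT => /forallP allJ.
    by apply/eqP/setP => l; rewrite inE allJ.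
  (* At [j] both [u] and [w] are minimal, and at every other place exactly one of them is: the
     values add up to [gamma j - 1] at [j] and to at least [gamma k] at any other [k]. *)
  have [|u [[x [Ix _ vx]] uJ]] := relmax (j |: ~: J)%SET.
    have jl : j != l by apply: contraNneq Jl => <-.
    rewrite (leq_trans _ (subset_leq_card (_ : [set j; l]%SET \subset _))) //.
      by rewrite cards2 jl.
    by rewrite finset.subUset !finset.sub1set !inE eqxx Jl orbT.
  apply: (no_complementary_values (f := alpha) (i := j) Ix KIy).
  + by have := uJ j; rewrite vx !inE eqxx => ->.
  + by have := wJ j; rewrite vy Jj betaE => ->.
  move=> k kj; have := uJ k; have := wJ k; rewrite !inE (negPf kj) /=.
  case: ifP => Jk /= yk xk.
    exists (alpha k + 1), (beta k); split; last by rewrite gammaE addrAC.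
      by rewrite vx lee_fin lezD1.
    by rewrite vy yk.
  exists (alpha k), (beta k + 1); split; last by rewrite gammaE addrA.
    by rewrite vx xk.
  by rewrite vy lee_fin lezD1.
Qed.

End Valuations.
Theorem theorem1p1 (R : comNzRingType) (m : idealr R)
    (Q : comUnitRingType) (iota : {rmorphism R -> Q})
    (frac : total_fractions iota)
    (adm : admissible iota m)
    (p : nat) (val : 'I_p -> Q -> \bar int) (hval : value_map iota val)
    (hp : (2 <= p)%N)
    (K0 : set Q) (canK0 : canonical_ideal iota K0)
    (RK0 : range iota `<=` K0) (K0R : K0 `<=` integral_closure iota)
    (gamma : {ffun 'I_p -> nat}) (hgamma : conductor iota val K0 gamma)
    (I : set Q) (fracI : fractional_ideal iota I)
    (alpha beta : {ffun 'I_p -> int})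
    (halpha : values val I alpha)
    (hbeta : values val (colon K0 I) beta)
    (hsum : alpha + beta = [ffun i => (gamma i)%:Z - 1]) :
  absolute_maximal val beta (colon K0 I) <-> relative_maximal val alpha I.
Proof.
have [[locR noethR dimR _] [_ resQ cardR]] := adm.
have [dv [v_fun v_injT _]] := hval.
have v_inj : injective (fun i => valuation_ring (val i)).
  by move=> i j; apply: v_injT; rewrite inE.
have v_ge0 i r : (0%:E <= val i (iota r))%E.
  by have [+ _] := v_fun i Logic.I; apply; exists r.
(* The bound on the number of valuation rings provides [p] pairwise incongruent residues. *)
have [r r_inj] := exists_residues cardR v_inj (fun i => v_fun i Logic.I).
apply: (absolute_maximal_dual frac locR noethR dimR dv v_ge0
  (Ordinal (ltnW hp)) canK0 hgamma resQ v_inj r_inj fracI halpha hbeta) => i.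
by move/ffunP: hsum => /(_ i); rewrite !ffunE.
Qed.
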